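(* Let $0 \le \Delta < 1$ and $a > 0$, and let $\eta_t = \{l_t, r_t\}$ be the two-point linear edge-reinforced process on $\mathbb{Z}$ with drift $\Delta$ and initial edge weight $a$, started from $l_0 < r_0$ (as described in the context). Then $(r_t - l_t)$ is recurrent: almost surely the two particles meet infinitely often, i.e. the set $\{t \ge 0 : l_t = r_t\}$ is almost surely unbounded.
   Context: The two-point linear edge-reinforced process on $\mathbb{Z}$ with drift $\Delta \ge 0$ and initial weight $a>0$ is defined as follows. Every edge $[v,v+1]$, $v\in\mathbb{Z}$, carries a weight $W_t(v,v+1)$, with $W_0(v,v+1)=a$ for all $v$. Two particles move on $\mathbb{Z}$; each carries an independent rate-one exponential clock (independent exponential waiting times with rate one between its jumps). When the clock of a particle located at site $v$ rings at time $t$, the particle jumps to $v+1$ with probability $$\frac{W_{t-}(v,v+1)+\Delta}{W_{t-}(v-1,v)+W_{t-}(v,v+1)+\Delta}$$ and to $v-1$ with probability $$\frac{W_{t-}(v-1,v)}{W_{t-}(v-1,v)+W_{t-}(v,v+1)+\Delta},$$ and the weight of the traversed edge is increased by $1$ (all other weights unchanged). The weights are shared by both particles. Denote by $l_t$ the position of the left particle and by $r_t$ that of the right particle at time $t$ (so $l_t \le r_t$; when $l_t=r_t$ the labels are immaterial). *)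

(* Defs.v *)
From HB Require Import structures.
From mathcomp Require Import all_boot all_order all_algebra.
From mathcomp Require Import all_classical all_reals all_analysis.
Set Implicit Arguments. Unset Strict Implicit. Unset Printing Implicit Defensive.
Import Order.TTheory GRing.Theory Num.Theory.
Import numFieldNormedType.Exports.
Local Open Scope classical_set_scope.
Local Open Scope ring_scope.

Definition mutually_independent d (T : measurableType d) (R : realType)
  (P : probability T R) (I : eqType) (X : I -> T -> R) : Prop :=
  (forall i, measurable_fun setT (X i)) /\
  forall (J : seq I) (B : I -> set R), uniq J -> (forall i, measurable (B i)) ->
    P (\big[setI/setT]_(i <- J) (X i @^-1` B i)) =
    (\prod_(i <- J) P (X i @^-1` B i))%E.

(* Two-point linear edge-reinforced process, built from its driving noise.  *)
(* Particles are labelled by bool.  Particle i carries a rate-one clock:    *)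
(* its k-th waiting time is E i k (Exp(1)), so its (k+1)-th ring happens at *)
(* time  clock_time E i k = E i 0 + ... + E i k.  At its (k+1)-th ring it   *)
(* jumps right iff U i k < (right probability), with U i k ~ Uniform[0,1]. *)
(* Weight of edge [v, v+1] is  w v.                                        *)

Record config (R : realType) := Config {
  cpos : bool -> int;
  cw : int -> R;           (* edge weights: cw v = W(v, v+1) *)
  ccnt : bool -> nat;
  ctime : R
}.

Section Process.
Variables (R : realType) (Delta a : R) (x0 : bool -> int).
Variables (E U : bool -> nat -> R).

Definition clock_time (i : bool) (k : nat) : R := \sum_(j < k.+1) E i j.

Definition right_prob (w : int -> R) (v : int) : R :=
  (w v + Delta) / (w (v - 1) + w v + Delta).

Definition incr_edge (w : int -> R) (e : int) : int -> R :=
  fun u => if u == e then w u + 1 else w u.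

Definition jump (c : config R) (i : bool) : config R :=
  let v := cpos c i in
  let u := U i (ccnt c i) in
  let right := u < right_prob (cw c) v in
  Config (fun j => if j == i then (if right then v + 1 else v - 1) else cpos c j)
         (incr_edge (cw c) (if right then v else v - 1))
         (fun j => if j == i then (ccnt c j).+1 else ccnt c j)
         (clock_time i (ccnt c i)).

Definition next_particle (c : config R) : bool :=
  clock_time true (ccnt c true) < clock_time false (ccnt c false).

Definition init_config : config R :=
  Config x0 (fun _ => a) (fun _ => 0%N) 0.

Fixpoint state (n : nat) : config R :=
  match n with
  | 0%N => init_config
  | n'.+1 => let c := state n' in jump c (next_particle c)
  end.

Definition pos_at (t : R) (i : bool) (p : int) : Prop :=
  exists n, ctime (state n) <= t < ctime (state n.+1) /\ cpos (state n) i = p.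

Definition meet_at (t : R) : Prop :=
  exists n, ctime (state n) <= t < ctime (state n.+1) /\
            cpos (state n) false = cpos (state n) true.

End Process.

Definition driving_family (T R : Type) (E U : bool -> nat -> T -> R)
  (k : (bool * nat) + (bool * nat)) : T -> R :=
  match k with inl (i, n) => E i n | inr (i, n) => U i n end.

(* Main.v *)
Require Import Defs.
From HB Require Import structures.
From mathcomp Require Import all_boot all_order all_algebra.
From mathcomp Require Import all_classical all_reals all_analysis.
From mathcomp Require Import measurable_realfun.
From mathcomp Require Import zify ring lra.
Import Order.TTheory GRing.Theory Num.Theory.
Set Implicit Arguments. Unset Strict Implicit. Unset Printing Implicit Defensive.
Local Open Scope classical_set_scope.
Local Open Scope ring_scope.

(** Let [Phi] be the sum of [1 / W] over the edges between the two particles,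
    i.e. their effective resistance.  Until they meet, [Phi] is a nonnegative
    supermartingale, whatever the order in which the clocks ring: when the right
    particle sits at [v], its next jump lowers [Phi] in expectation by
    [(1 - Delta) / ((w v + 1) * (w (v - 1) + w v + Delta))], and by at least the
    mirror image of this for the left particle.  Hence the sum of these
    decrements up to the meeting time is almost surely finite.

    Without a further meeting the sum diverges.  At the [j]-th move that the
    right particle makes from its running maximum [v], the outward edge still has
    its original weight while the inward edge has been crossed at most [2 j + 1]
    times more, so that infinitely many such moves contribute a harmonic series.
    If there are only finitely many of them, for both particles, the walks are
    confined to a finite interval; restarting the count from the largest site that
    the right particle visits infinitely often makes all its visits there moves
    from the running maximum, again infinitely many. *)

(** * Two separated nearest-neighbour walks *)

Section TwoWalks.
Variable R : realType.

Definition nn_step (x y : int) (w w' : int -> R) : Prop :=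
  (y = x + 1 /\ w' = incr_edge w x) \/ (y = x - 1 /\ w' = incr_edge w (x - 1)).

(** A path of the jump chain stripped of its times, with an arbitrary order of moves. Separation is
    built in: staying below the right walk, the left one leaves the edges from [[r n - 1, r n]]
    upwards untouched. *)
Definition two_walks (r l : nat -> int) (w : nat -> int -> R)
    (mr : nat -> bool) : Prop :=
  forall n, l n < r n /\
    if mr n then l n.+1 = l n /\ nn_step (r n) (r n.+1) (w n) (w n.+1)
    else r n.+1 = r n /\ nn_step (l n) (l n.+1) (w n) (w n.+1).

(* Edge [v, v + 1], indexed by [v], is reflected to [- v - 1, - v]. *)
Definition mirror (w : int -> R) : int -> R := fun u => w (- u - 1).

Lemma nn_step_mirror x y w w' :
  nn_step x y w w' -> nn_step (- x) (- y) (mirror w) (mirror w').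
Proof.
have E (v u : int) : (- u - 1 == v) = (u == - v - 1) by lia.
case=> [][-> ->]; [right|left]; (split; first by lia);
  apply/funext => u; rewrite /mirror /incr_edge E //.
by congr (if _ == _ then _ else _); lia.
Qed.

Lemma two_walks_mirror r l w mr : two_walks r l w mr ->
  two_walks (fun n => - l n) (fun n => - r n) (fun n => mirror (w n))
    (fun n => ~~ mr n).
Proof.
move=> H n; have [lr] := H n; split; first by lia.
case: (mr n) b => /= -[-> /nn_step_mirror ?]; split => //.
Qed.

Lemma two_walks_shift N r l w mr : two_walks r l w mr ->
  two_walks (fun n => r (n + N)%N) (fun n => l (n + N)%N)
    (fun n => w (n + N)%N) (fun n => mr (n + N)%N).
Proof. by move=> H n; have := H (n + N)%N. Qed.

Lemma nn_step_weight_le x y w w' u :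
  nn_step x y w w' -> w u <= w' u <= w u + 1.
Proof. by case=> [][_ ->]; rewrite /incr_edge; case: ifP => _; lra. Qed.

Lemma two_walks_weight_le A r l w mr : two_walks r l w mr ->
  (forall u, w 0%N u <= A) -> forall n u, w n u <= A + n%:R.
Proof.
move=> H w0; elim=> [|n IH] u; first by rewrite addr0.
have /andP[_ st] : w n u <= w n.+1 u <= w n u + 1.
  have [_] := H n; case: ifP => _ [_]; exact: nn_step_weight_le.
by have := IH u; rewrite -natr1; lra.
Qed.

Lemma two_walks_weight_gt0 r l w mr : two_walks r l w mr ->
  (forall u, 0 < w 0%N u) -> forall n u, 0 < w n u.
Proof.
move=> H w0; elim=> [//|n IH] u; apply: lt_le_trans (IH u) _.
suff /andP[] : w n u <= w n.+1 u <= w n u + 1 by [].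
by have [_] := H n; case: ifP => _ [_]; exact: nn_step_weight_le.
Qed.

Lemma harmonic_sum_unbounded (C : R) :
  exists J, C < \sum_(j < J) j.+1%:R^-1.
Proof.
apply: contrapT => /forallNP noJ; apply: (@dvg_harmonic R).
apply: nondecreasing_is_cvgn.
  by apply: nondecreasing_series => n _ _; exact: harmonic_ge0.
exists C => _ [n _ <-]; rewrite /series/= big_mkord leNgt; apply/negP; exact: noJ.
Qed.

(* At least this much is lost in expectation by the potential of the two walks
   at a step of a walk whose outward and inward edges weigh [wo] and [wi]. *)
Definition drift (Delta wo wi : R) : R :=
  (1 - Delta) / ((wo + 1) * (wo + wi + Delta)).

(** * Moves from the running maximum *)

Section Records.
Variables (r l : nat -> int) (w : nat -> int -> R) (mr : nat -> bool).
Hypothesis walks : two_walks r l w mr.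
Variable m0 : int.
Hypothesis r0m0 : r 0%N <= m0.

(** The initial value [m0] may exceed [r 0], so that the count can be restarted from a site chosen
    in advance. *)
Fixpoint runmax (n : nat) : int :=
  if n is n'.+1 then
    if runmax n' < r n then r n else runmax n'
  else m0.

(** A move that starts at the running maximum, in either direction, rather than one that reaches a
    new maximum. *)
Definition record_move n := mr n && (r n == runmax n).

Definition record_count n := (\sum_(k < n) record_move k)%N.

Lemma record_countS n : record_count n.+1 = (record_count n + record_move n)%N.
Proof. by rewrite /record_count big_ord_recr. Qed.

Lemma runmax_ge n : r n <= runmax n.
Proof. by elim: n => [|n IH] //=; case: ifP => //; lia. Qed.

Lemma runmax_le n k : (n <= k)%N -> runmax n <= runmax k.
Proof.
elim: k => [|k IH]; first by rewrite leqn0 => /eqP ->.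
rewrite leq_eqVlt => /predU1P[->//|/IH] /=; case: ifP; lia.
Qed.

Lemma runmax_step n : ~~ record_move n -> runmax n.+1 = runmax n.
Proof.
rewrite /record_move /=; have := runmax_ge n; have [lr] := walks n.
case: (mr n) => /= [[_ st]|[-> _]] rm; last by rewrite ltNge rm.
by case: ifP => //; case: st => -[-> _]; lia.
Qed.

(* A step into a new record crosses an edge of weight at most [A]; afterwards
   the edge below the record is crossed at most twice per move made there. *)
Lemma record_weight_le A n : (forall u, m0 - 1 <= u -> w 0%N u <= A) ->
  (forall u, runmax n <= u -> w n u <= A) /\
  w n (runmax n - 1) <= A + (2 * record_count n + (r n == runmax n))%:R.
Proof.
move=> wA; elim: n => [|n [IH1 IH2]].
  split=> [u mu|]; first by apply: wA => /=; move: mu => /=; lia.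
  by rewrite (le_trans (wA _ _))//= lerDl.
have rm := runmax_ge n; have [lr] := walks n.
have [lr' _] := walks n.+1.
rewrite record_countS /= /record_move.
case: (mr n) => /= [[ll st]|[rr st]]; last first.
  have E u : runmax n - 1 <= u -> w n.+1 u = w n u.
    move=> mu; case: st => -[lE ->]; rewrite /incr_edge; case: eqP => // ?; lia.
  rewrite rr ltNge rm /= addn0; split => [u mu|]; last by rewrite E.
  by rewrite E; [exact: IH1|lia].
case: (eqVneq (r n) (runmax n)) => [e|ne].
  case: st => -[-> ->].
    rewrite e ltrDl ltr01; split=> [u mu|].
      by rewrite /incr_edge; case: eqP => [?|_]; [lia|apply: IH1; lia].
    rewrite addrK /incr_edge !eqxx; have w1 := IH1 _ (lexx _).
    apply: (@le_trans _ _ (A + 1)); first by rewrite lerD2r.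
    by rewrite lerD2l ler1n; lia.
  rewrite e ifF; last by lia.
  split=> [u mu|].
    by rewrite /incr_edge; case: eqP => [?|_]; [lia|apply: IH1; lia].
  rewrite /incr_edge eqxx; move: IH2; rewrite e eqxx (_ : _ == _ = false); last by lia.
  move=> w1; rewrite (_ : (_ + _)%N = (2 * record_count n + 1 + 1)%N); last by lia.
  by rewrite natrD addrA lerD2r.
rewrite addn0; have {}rm : r n < runmax n by lia.
have w1 u : runmax n <= u -> w n.+1 u = w n u.
  by move=> mu; case: st => -[_ ->]; rewrite /incr_edge; case: eqP => // ?; lia.
rewrite ifF; last by case: st => -[-> _]; lia.
split=> [u mu|]; first by rewrite w1 //; exact: IH1.
move: IH2; rewrite (negbTE ne) addn0 => IH2.
(* A return to the maximum crosses the edge below it once, and the indicator of [r n == runmax n]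
   pays for this. The downward crossing is itself a record move, hence the factor 2. *)
case: st => -[-> ->]; rewrite /incr_edge.
  have -> : (r n + 1 == runmax n) = (runmax n - 1 == r n) by lia.
  by case: eqP => _; rewrite natrD /= ?addr0//; lra.
rewrite (_ : _ == r n - 1 = false); last by lia.
by rewrite (le_trans IH2)// lerD2l ler_nat; lia.
Qed.

Variables (Delta A C : R) (delta : nat -> R).
Hypothesis Delta_ge0 : 0 <= Delta.
Hypothesis Delta_lt1 : Delta < 1.
Hypothesis w_gt0 : forall u, 0 < w 0%N u.
Hypothesis w_le : forall u, w 0%N u <= A.
Hypothesis delta_ge0 : forall n, 0 <= delta n.
Hypothesis delta_ge :
  forall n, mr n -> drift Delta (w n (r n)) (w n (r n - 1)) <= delta n.
Hypothesis delta_sum : forall n, \sum_(k < n) delta k <= C.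

Let A_gt0 : 0 < A. Proof. exact: lt_le_trans (w_gt0 0) (w_le 0). Qed.

(** After [j] record moves the outward and inward weights at the maximum are at most [A] and
    [A + 2 j + 1]. Since [2 A + 2 j + 1 + Delta <= (j + 1) (2 A + 2 + Delta)], the next record move
    loses at least [kappa / (j + 1)]. *)
Let kappa := (1 - Delta) / ((A + 1) * (2 * A + 2 + Delta)).

Let kappa_gt0 : 0 < kappa.
Proof. by rewrite divr_gt0 ?mulr_gt0//; move: A_gt0 Delta_ge0 Delta_lt1; lra. Qed.

Let record_delta_ge n :
  record_move n -> kappa / (record_count n).+1%:R <= delta n.
Proof.
move=> /andP[mrn /eqP rm]; apply: le_trans (delta_ge mrn); rewrite rm.
have [w1 w2] := record_weight_le n (fun u _ => w_le u).
have := w1 _ (lexx _); move: w2; rewrite rm eqxx natrD natrM => w2 {}w1.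
have p1 := two_walks_weight_gt0 walks w_gt0 n (runmax n).
have p2 := two_walks_weight_gt0 walks w_gt0 n (runmax n - 1).
rewrite /drift /kappa -mulrA -invfM ler_wpM2l ?subr_ge0 ?(ltW Delta_lt1)//.
move: A_gt0 Delta_ge0 => A0 D0; move: w2 => /=; rewrite -[(record_count n).+1%:R]natr1.
have : 0 <= (record_count n)%:R :> R by [].
move: (_%:R) => x x0 w2; have xA : 0 <= x * (2 * A + Delta) by rewrite mulr_ge0//; lra.
rewrite lef_pV2 ?posrE; [|by rewrite !mulr_gt0//; lra..].
by rewrite -mulrA ler_pM //; lra.
Qed.

(** Infinitely many record moves would make the sums of [delta] dominate a multiple of the harmonic
    series, against the bound [C]. *)
Lemma record_moves_finite : exists K, forall n, (K <= n)%N -> ~~ record_move n.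
Proof.
have [J CJ] := harmonic_sum_unbounded (C / kappa).
have rc n : (record_count n <= J)%N.
  have H : kappa * \sum_(j < record_count n) j.+1%:R^-1 <= C.
    apply: le_trans (delta_sum n); elim: n => [|n IH].
      by rewrite /record_count !big_ord0 mulr0.
    rewrite record_countS big_ord_recr /=; case: (boolP (record_move n)) => [T|_]; last first.
      by rewrite addn0 ler_wpDr.
    by rewrite addn1 big_ord_recr /= mulrDr lerD// record_delta_ge.
  rewrite leqNgt; apply/negP => Jn; move: CJ; rewrite ltNge => /negP; apply.
  rewrite ler_pdivlMr// mulrC (le_trans _ H)// ler_pM2l//.
  rewrite -(subnKC (ltnW Jn)) big_split_ord/= lerDl sumr_ge0//.
apply: contrapT => /forallNP noK.
have {}noK K : exists2 n, (K <= n)%N & record_move n.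
  have /existsNP[n /not_implyP[Kn /negP/negPn ?]] := noK K; by exists n.
have : forall j, exists n, (j <= record_count n)%N.
  elim=> [|j [n jn]]; first by exists 0%N.
  have [k nk T] := noK n; exists k.+1; rewrite record_countS T addn1 ltnS.
  rewrite (leq_trans jn)// /record_count -(subnKC nk) big_split_ord/= leq_addr//.
by move=> /(_ J.+1)[n]; rewrite ltnNge rc.
Qed.

(** The maximum grows only through record moves, so it is frozen after the last of them. *)
Lemma walk_bounded_above : exists q : int, forall n, r n <= q.
Proof.
have [K HK] := record_moves_finite; exists (runmax K) => n.
have E k : runmax (K + k) = runmax K.
  by elim: k => [|k IH]; rewrite ?addn0// addnS runmax_step ?HK ?leq_addr.
rewrite (le_trans (runmax_ge _))// -(E n) runmax_le// leq_addl//.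
Qed.

End Records.

(** * Confinement to an interval *)

Section Confinement.
Variables (r l : nat -> int) (w : nat -> int -> R) (mr : nat -> bool).
Hypothesis walks : two_walks r l w mr.
Variables (Delta A C : R) (delta : nat -> R).
Hypothesis Delta_ge0 : 0 <= Delta.
Hypothesis Delta_lt1 : Delta < 1.
Hypothesis w_gt0 : forall u, 0 < w 0%N u.
Hypothesis w_le : forall u, w 0%N u <= A.
Hypothesis delta_ge0 : forall n, 0 <= delta n.
Hypothesis delta_geR :
  forall n, mr n -> drift Delta (w n (r n)) (w n (r n - 1)) <= delta n.
Hypothesis delta_geL :
  forall n, ~~ mr n -> drift Delta (w n (l n - 1)) (w n (l n)) <= delta n.
Hypothesis delta_sum : forall n, \sum_(k < n) delta k <= C.
Hypothesis movesR : forall K, exists2 n, (K <= n)%N & mr n.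

Lemma two_walks_drift_unsummable : False.
Proof.
have [q rq] : exists q : int, forall n, r n <= q.
  exact: (walk_bounded_above walks (lexx _) Delta_ge0 Delta_lt1 w_gt0 w_le
    delta_ge0 delta_geR delta_sum).
(* Reflection turns the left walk into a right walk. *)
have [p lp] : exists q : int, forall n, - l n <= q.
  apply: (walk_bounded_above (two_walks_mirror walks) (lexx _) Delta_ge0
    Delta_lt1 _ _ delta_ge0 _ delta_sum (A := A)) => [u|u|n mL].
  - exact: w_gt0.
  - exact: w_le.
  - rewrite /mirror; apply: le_trans (delta_geL mL).
    have -> : - (- l n) - 1 = l n - 1 by lia.
    by have -> : - (- l n - 1) - 1 = l n by lia.
have pr n : - p < r n by have := lp n; have [] := walks n; lia.
(* The site [- p + k] is the least eventual upper bound of [r]; as [- p < r n], the candidates can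
   be indexed by natural numbers. *)
have [k kN kmin] : exists2 k : nat, (exists N, forall n, (N <= n)%N -> r n <= - p + k%:Z) &
   forall j : nat, (exists N, forall n, (N <= n)%N -> r n <= - p + j%:Z) -> (k <= j)%N.
  pose Q k := `[< exists N, forall n, (N <= n)%N -> r n <= - p + k%:Z >].
  have exQ : exists k, Q k.
    exists (absz (q + p)); apply/asboolP; exists 0%N => n _.
    by have := rq n; have := pr n; lia.
  case: (ex_minnP exQ) => k /asboolP Qk kmin; exists k => // j Hj.
  by apply: kmin; apply/asboolP.
have [N rN] := kN.
(* Were the site avoided from some time on, [k - 1] would be an eventual bound too; [k = 0] is
   excluded by [- p < r n]. *)
have visits K : exists2 n, (K <= n)%N & r n = - p + k%:Z.
  apply: contrapT => nov.
  case: k => [|k] in kN kmin rN nov *.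
    by have := rN N (leqnn _); have := pr N; lia.
  suff : (k.+1 <= k)%N by rewrite ltnn.
  apply: kmin; exists (maxn K N) => n; rewrite geq_max => /andP[Kn Nn].
  have := rN _ Nn; have : r n <> - p + k.+1%:Z by move=> e; apply: nov; exists n.
  lia.
have walksN := two_walks_shift N walks.
have r0 : r (0 + N)%N <= - p + k%:Z by exact: rN.
(* The count restarts at time [N], when weights are at most [A + N], with this site as [m0]. The
   running maximum then never changes, so every move of the right walk from the site is a record
   move. *)
have [K HK] : exists K, forall n, (K <= n)%N ->
    ~~ record_move (fun n => r (n + N)%N) (fun n => mr (n + N)%N) (- p + k%:Z) n.
  apply: (record_moves_finite walksN r0 Delta_ge0 Delta_lt1 (A := A + N%:R) (C := C)
    (delta := fun n => delta (n + N)%N)) => [u|u|n|n|n].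
  - exact: two_walks_weight_gt0.
  - exact: two_walks_weight_le.
  - exact: delta_ge0.
  - exact: delta_geR.
  - apply: le_trans (delta_sum (N + n)); rewrite big_split_ord/=.
    rewrite ler_wpDl ?sumr_ge0//; apply: ler_sum => i _; by rewrite addnC.
have runmaxE n : runmax (fun n => r (n + N)%N) (- p + k%:Z) n = - p + k%:Z.
  elim: n => //= n ->; case: ifP => //; have := rN (n.+1 + N)%N (leq_addl _ _); lia.
have [n0 Kn0 rn0] := visits (K + N)%N.
(* Only the left walk moves between the visit at [n0] and the next move of the right walk, so that
   move starts at the site. *)
have /ex_minnP[n /andP[n0n mrn] nmin] : exists n, (n0 <= n)%N && mr n.
  by have [n ? ?] := movesR n0; exists n; apply/andP.
have rn : r n = - p + k%:Z.
  have : forall j, (n0 + j <= n)%N -> r (n0 + j)%N = - p + k%:Z.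
    elim=> [|j IH] jn; first by rewrite addn0.
    have [_] := walks (n0 + j)%N; rewrite addnS; case: ifPn => [mj _|_ [-> _]].
      by have := nmin (n0 + j)%N; rewrite leq_addr mj => /(_ isT); lia.
    by apply: IH; lia.
  by move=> /(_ (n - n0)%N); rewrite subnKC//; exact.
have /negP := HK (n - N)%N ltac:(lia); apply.
by rewrite /record_move runmaxE /= subnK ?mrn ?rn ?eqxx//; lia.
Qed.

End Confinement.
End TwoWalks.

(** * The effective resistance between the particles *)

Section Resistance.
Variable R : realType.
Implicit Types (w : int -> R) (x y : int).

Definition path_resistance w x (n : nat) : R := \sum_(k < n) (w (x + k%:Z))^-1.

Lemma path_resistance_recl w x n :
  path_resistance w x n.+1 = (w x)^-1 + path_resistance w (x + 1) n.
Proof.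
rewrite /path_resistance big_ord_recl addr0; congr (_ + _).
by apply: eq_bigr => k _; rewrite lift0 -addrA.
Qed.

Lemma path_resistance_recr w x n :
  path_resistance w x n.+1 = path_resistance w x n + (w (x + n%:Z))^-1.
Proof. by rewrite /path_resistance big_ord_recr. Qed.

Lemma path_resistance_incr w x n e : (e < x) || (x + n%:Z <= e) ->
  path_resistance (incr_edge w e) x n = path_resistance w x n.
Proof.
move=> ex; apply: eq_bigr => k _; rewrite /incr_edge; case: eqP => // H.
by have := ltn_ord k; lia.
Qed.

(* The effective resistance between [x] and [y] when edge weights are
   conductances. *)
Definition resistance w x y : R :=
  path_resistance w (if x < y then x else y) (absz (x - y)).

Lemma resistance_sym w x y : resistance w x y = resistance w y x.
Proof.
rewrite /resistance; have -> : absz (x - y) = absz (y - x) by lia.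
by congr path_resistance; case: ltgtP.
Qed.

Lemma resistance_ge0 w x y : (forall u, 0 < w u) -> 0 <= resistance w x y.
Proof. by move=> w0; apply: sumr_ge0 => k _; rewrite invr_ge0 ltW. Qed.

Lemma resistanceE w x n :
  resistance w x (x + n%:Z) = path_resistance w x n.
Proof.
rewrite /resistance (_ : absz _ = n); last by lia.
by case: n => [|n]; [rewrite addr0 ltxx|rewrite ifT//; lia].
Qed.

(** A step away from [u] appends the crossed edge with its increased weight; a step towards [u]
    deletes the crossed edge. For [u < v] the two contributions balance to an equality. *)
Lemma resistance_drift Delta w u v :
  let rho := right_prob Delta w v in
  0 <= Delta -> (forall e, 0 < w e) -> u != v ->
  rho * resistance (incr_edge w v) (v + 1) u +
  (1 - rho) * resistance (incr_edge w (v - 1)) (v - 1) u +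
  (if u < v then drift Delta (w v) (w (v - 1))
   else drift Delta (w (v - 1)) (w v)) <= resistance w v u.
Proof.
move=> rho D0 w0 uv.
have pv := w0 v; have pv1 := w0 (v - 1).
rewrite {}/rho /right_prob; case: ltP => [uv'|vu].
  have [n nE] : exists n : nat, v = u + n.+1%:Z.
    by exists (absz (v - u)).-1; lia.
  rewrite !(resistance_sym _ _ u).
  have -> : resistance (incr_edge w v) u (v + 1) =
      resistance w u v + (w v + 1)^-1.
    rewrite nE (_ : u + _ + 1 = u + n.+2%:Z); last by lia.
    rewrite !resistanceE path_resistance_recr path_resistance_incr; last by lia.
    by rewrite /incr_edge eqxx.
  have -> : resistance (incr_edge w (v - 1)) u (v - 1) =
      resistance w u v - (w (v - 1))^-1.
    rewrite nE (_ : u + _ - 1 = u + n%:Z); last by lia.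
    rewrite !resistanceE path_resistance_recr path_resistance_incr; last by lia.
    by rewrite addrK.
  rewrite /drift le_eqVlt; apply/orP; left; apply/eqP.
  field; rewrite !gt_eqF//; lra.
have [n nE] : exists n : nat, u = v + n.+1%:Z by exists (absz (u - v)).-1; lia.
have -> : resistance (incr_edge w (v - 1)) (v - 1) u =
    resistance w v u + (w (v - 1) + 1)^-1.
  rewrite nE [X in resistance (incr_edge _ _) _ X](_ : _ = (v - 1) + n.+2%:Z); last by lia.
  rewrite !resistanceE path_resistance_recl subrK path_resistance_incr; last by lia.
  by rewrite /incr_edge eqxx addrC.
have -> : resistance (incr_edge w v) (v + 1) u = resistance w v u - (w v)^-1.
  rewrite nE [X in resistance (incr_edge _ _) _ X](_ : _ = (v + 1) + n%:Z); last by lia.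
  rewrite !resistanceE path_resistance_recl path_resistance_incr; last by lia.
  by rewrite [(w v)^-1 + _]addrC addrK.
(* For [v < u] the bias [Delta] pushes towards [u], which leaves an explicit nonnegative surplus. *)
rewrite /drift -subr_ge0.
suff -> : forall r, r - ((w v + Delta) / (w (v - 1) + w v + Delta) * (r - (w v)^-1) +
    (1 - (w v + Delta) / (w (v - 1) + w v + Delta)) * (r + (w (v - 1) + 1)^-1) +
    (1 - Delta) / ((w (v - 1) + 1) * (w (v - 1) + w v + Delta))) =
    Delta * ((w v)^-1 + (w (v - 1) + 1)^-1) / (w (v - 1) + w v + Delta).
  by rewrite divr_ge0 ?mulr_ge0 ?addr_ge0 ?invr_ge0//; lra.
move=> r; field; rewrite !gt_eqF//; lra.
Qed.

End Resistance.

(** * Independence of disjoint subfamilies *)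

Section Independence.
Context (R : realType) (d : measure_display) (T : measurableType d).
Variables (P : probability T R) (I : choiceType) (X : I -> T -> R).
Hypothesis indX : mutually_independent P X.

Definition cylinder (J : seq I) (B : I -> set R) : set T :=
  \big[setI/setT]_(i <- J) (X i @^-1` B i).

Lemma cylinderP J B t : cylinder J B t <-> forall i, i \in J -> B i (X i t).
Proof. by rewrite /cylinder -bigcap_seq; split=> H i; exact: H. Qed.

Lemma measurable_cylinder J B :
  (forall i, measurable (B i)) -> measurable (cylinder J B).
Proof.
move=> mB; rewrite /cylinder; apply: bigsetI_measurable => i _.
by rewrite -[_ @^-1` _]setTI; apply: indX.1.
Qed.

Definition cylinders (K : pred I) : set (set T) :=
  [set A | exists J B, [/\ uniq J, all K J, (forall i, measurable (B i)) &
    A = cylinder J B]].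

Lemma cylinders_setI_closed K : setI_closed (cylinders K).
Proof.
move=> _ _ [J1 [B1 [uJ1 KJ1 mB1 ->]]] [J2 [B2 [uJ2 KJ2 mB2 ->]]].
exists (undup (J1 ++ J2)).
exists (fun i => (if i \in J1 then B1 i else setT) `&`
                 (if i \in J2 then B2 i else setT)); split.
- exact: undup_uniq.
- by apply/allP => i; rewrite mem_undup mem_cat => /orP[]; exact/allP.
- by move=> i; apply: measurableI; case: ifP.
- apply/seteqP; split=> t.
    move=> [/cylinderP H1 /cylinderP H2]; apply/cylinderP => i _.
    by split; case: ifP => // ?; [exact: H1|exact: H2].
  move=> /cylinderP H; split; apply/cylinderP => i iJ.
    by have [] := H i; rewrite ?mem_undup ?mem_cat ?iJ.
  by have [] := H i; rewrite ?mem_undup ?mem_cat ?iJ ?orbT.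
Qed.

(** The sigma-algebra generated by the [X i] with [K i], as a second measurable structure on the
    points of [T]. *)
Definition sub_sigma (K : pred I) := g_sigma_algebraType (cylinders K).

Lemma measurable_sub_sigma (K : pred I) i : K i -> measurable_fun setT (X i : sub_sigma K -> R).
Proof.
move=> Ki _ B mB; rewrite setTI; apply: sub_sigma_algebra.
exists [:: i], (fun=> B); split => //=; first by rewrite Ki.
by rewrite /cylinder big_seq1.
Qed.

(** Dynkin's argument: the sets with the product formula form a lambda-system containing the
    pi-system of cylinders over [K]. Measurability in [T] is carried along in the induction. *)
Lemma cylinder_indep (K : pred I) J B (A : set T) : uniq J ->
  all [predC K] J -> (forall i, measurable (B i)) ->
  measurable (A : set (sub_sigma K)) ->
  measurable A /\ P (A `&` cylinder J B) = (P A * P (cylinder J B))%E.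
Proof.
move=> uJ KJ mB; have mC := measurable_cylinder J mB.
have Pfin S : measurable S -> P S \is a fin_num by move=> mS; exact: fin_num_measure.
apply: (@dynkin_induction _ (sub_sigma K) (cylinders K)
  (fun A : set T => measurable A /\ P (A `&` cylinder J B) = (P A * P (cylinder J B))%E)) => //.
- exact: cylinders_setI_closed.
- by split => //; rewrite setTI probability_setT mul1e.
- move=> _ [J' [B' [uJ' KJ' mB' ->]]]; split; first exact: measurable_cylinder.
  (* The index lists are disjoint, so one family of constraints serves both cylinders and
     independence applies to the concatenated list. *)
  pose BB i := if i \in J' then B' i else B i.
  have JJ' i : i \in J -> (i \in J') = false.
    by move=> /(allP KJ)/= nK; apply/negP => /(allP KJ'); exact/negP.
  have E1 : cylinder J' BB = cylinder J' B'.
    by apply: eq_big_seq => i iJ; rewrite /BB iJ.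
  have E2 : cylinder J BB = cylinder J B.
    by apply: eq_big_seq => i iJ; rewrite /BB JJ'.
  have mBB i : measurable (BB i) by rewrite /BB; case: ifP.
  rewrite -E1 -E2 -big_cat /= [LHS]indX.2//; last first.
    rewrite cat_uniq uJ' uJ andbT /=; apply/hasPn => i iJ; by rewrite JJ'.
  by rewrite big_cat /= -!indX.2.
- move=> S _ [mS PS]; split; first exact: measurableC.
  have E : (P (cylinder J B) = P (~` S `&` cylinder J B) + P S * P (cylinder J B))%E.
    by rewrite -PS [~` S `&` _]setIC -setDE [S `&` _]setIC -measureDI.
  rewrite probability_setC//; move: E.
  move: (Pfin S mS) (Pfin _ mC) (Pfin _ (measurableI _ _ (measurableC mS) mC)).
  case: (P S) => // s _; case: (P (cylinder J B)) => // c _.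
  by case: (P (_ `&` _)) => // x _ [E]; congr EFin; lra.
move=> F _ tF HF; split; first by apply: bigcup_measurable => k _; exact: (HF k).1.
have mF k := (HF k).1.
rewrite setI_bigcupl !measure_bigcup//=; last 2 first.
  by move=> k _; exact: measurableI.
  by apply: trivIset_setIr.
rewrite muleC -(fineK (Pfin _ mC)) -nneseriesZl//.
by apply: eq_eseriesr => k _; rewrite (HF k).2 muleC fineK ?Pfin.
Qed.

End Independence.

(** * The clocks *)

Section Distributions.
Variable R : realType.
Local Notation mu := (@lebesgue_measure R).

(** The density is at most 1 on the half-line and vanishes elsewhere. *)
Lemma exponential_prob1_le (A : set R) : measurable A ->
  (exponential_prob 1 A <= mu (A `&` [set x | (0 <= x)%R]))%E.
Proof.
move=> mA; have -> : [set x : R | 0 <= x] = `[0, +oo[%classic.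
  by apply/seteqP; split=> x /=; rewrite in_itv/= andbT.
have -> : exponential_prob 1 A =
    (\int[mu]_(x in A `&` `[0%R, +oo[%classic) (expR (- x))%:E)%E.
  rewrite integral_mkcondr; apply: eq_integral => x _.
  rewrite /exponential_pdf !patchE; case: ifP => // _.
  by rewrite mul1r mulN1r.
have mI : measurable (A `&` `[0, +oo[%classic) by exact: measurableI.
apply: (@le_trans _ _ (\int[mu]_(x in A `&` `[0%R, +oo[%classic) (cst 1 x))%E); last first.
  by rewrite integral_cst// mul1e.
apply: ge0_le_integral => //=.
- apply/measurable_EFinP/measurable_funTS.
  exact: measurableT_comp.
- move=> x [_ /=]; rewrite in_itv/= andbT => x0.
  by rewrite lee_fin expR_le1 oppr_le0.
Qed.

Lemma uniform_prob_lt (rho : R) : 0 <= rho <= 1 ->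
  uniform_prob (@ltr01 R) `]-oo, rho[%classic = rho%:E.
Proof.
move=> /andP[r0 r1]; rewrite /uniform_prob integral_uniform_pdf.
have mI : measurable (`]-oo, rho[%classic `&` `[0, 1]%classic) by exact: measurableI.
rewrite (eq_integral (cst 1%E)) => [|x]; last first.
  by rewrite inE => -[_ /=]; rewrite in_itv/= /uniform_pdf subr0 invr1 => ->.
rewrite integral_cst// mul1e (_ : _ `&` _ = `[0%R, rho[%classic).
  rewrite /= lebesgue_measure_itv/= lte_fin sube0; case: ltP => // r0'.
  by congr EFin; apply/eqP; rewrite eq_le r0 r0'.
apply/seteqP; split=> x /=; rewrite !in_itv/=; first by move=> [-> /andP[->]].
by move=> /andP[x0 xr]; rewrite xr x0 (ltW (lt_le_trans xr r1)).
Qed.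

End Distributions.

Section Clocks.
Context (R : realType) (d : measure_display) (T : measurableType d).
Variables (P : probability T R) (E U : bool -> nat -> T -> R).
Hypothesis indEU : mutually_independent P (driving_family E U).
Hypothesis expE : forall i n B, measurable B ->
  P (E i n @^-1` B) = exponential_prob 1 B.

Let measurable_E i n : measurable_fun setT (E i n).
Proof. exact: (indEU.1 (inl (i, n))). Qed.

Lemma waiting_time_gt0 : {ae P, forall w, forall i n, 0 < E i n w}.
Proof.
suff H i n : P.-negligible (E i n @^-1` `]-oo, 0]%classic).
  have := negligible_bigcup (fun k => H false k).
  have := negligible_bigcup (fun k => H true k).
  move=> H1 H2; apply: negligibleS (negligibleU H1 H2) => w /=.
  move=> /existsNP[[|] /existsNP[n /negP]]; rewrite -leNgt => Ew; [left|right];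
    by exists n => //=; rewrite in_itv.
have mE : measurable (E i n @^-1` `]-oo, 0]%classic).
  by rewrite -[_ @^-1` _]setTI; exact: measurable_E.
suff P0 : P (E i n @^-1` `]-oo, 0]%classic) = 0%E by exact/negligibleP.
apply/eqP; rewrite eq_le measure_ge0 andbT expE//.
apply: le_trans (exponential_prob1_le _) _ => //.
rewrite (_ : _ `&` _ = [set 0]) ?lebesgue_measure_set1//.
apply/seteqP; split=> x /=; rewrite !in_itv/=.
  by move=> [x0 x1]; apply/eqP; rewrite eq_le x0.
by move=> ->.
Qed.

Let low : set R := `]-oo, 2^-1]%classic.

Let mlow : measurable low. Proof. exact: measurable_itv. Qed.

Lemma waiting_time_le_half i n : (P (E i n @^-1` low) <= (2^-1)%:E)%E.
Proof.
rewrite expE//; apply: le_trans (exponential_prob1_le _) _ => //.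
rewrite (_ : _ `&` _ = `[0%R, 2^-1]%classic).
  by rewrite /= lebesgue_measure_itv/= lte_fin invr_gt0 ltr0n sube0.
apply/seteqP; split=> x /=; rewrite !in_itv/=.
  by move=> [? ?]; apply/andP.
by move=> /andP[].
Qed.

(** By independence, [k] successive waiting times are all at most one half with probability at most
    [2^-k]. This makes the clock times diverge. *)
Lemma waiting_time_gt_half : {ae P, forall w, forall i m,
  exists2 n, (m <= n)%N & 2^-1 < E i n w}.
Proof.
pose S i m := \bigcap_(n in [set n | (m <= n)%N]) (E i n @^-1` low).
suff H i m : P.-negligible (S i m).
  have := negligible_bigcup (fun k => H false k).
  have := negligible_bigcup (fun k => H true k).
  move=> H1 H2; apply: negligibleS (negligibleU H1 H2) => w /=.
  move=> /existsNP[i /existsNP[m Em]].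
  have Sw : S i m w.
    move=> n /= mn; rewrite /low/= in_itv/= leNgt; apply/negP => En.
    by apply: Em; exists n.
  by case: i Em Sw => Em Sw; [left|right]; exists m.
have mS : measurable (S i m).
  apply: bigcap_measurable => [|n _]; first by exists m => /=.
  by rewrite -[_ @^-1` _]setTI; exact: measurable_E.
suff P0 : P (S i m) = 0%E by exact/negligibleP.
apply/eqP; rewrite eq_le measure_ge0 andbT.
have H k : (P (S i m) <= ((2^-1) ^+ k)%:E)%E.
  pose J : seq ((bool * nat) + (bool * nat)) := [seq inl (i, n) | n <- iota m k].
  have uJ : uniq J by rewrite map_inj_uniq ?iota_uniq// => x y [].
  have mB (j : (bool * nat) + (bool * nat)) : measurable low by exact: mlow.
  apply: (@le_trans _ _ (P (cylinder (driving_family E U) J (fun=> low)))).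
    apply: le_measure; rewrite ?inE//; first exact: (measurable_cylinder indEU).
    move=> w Sw; apply/cylinderP => _ /mapP[n nm ->] /=.
    by apply: Sw; move: nm; rewrite mem_iota => /andP[].
  rewrite indEU.2// /J big_map; elim: k (m) {uJ J} => [|k IH] m' /=.
    by rewrite big_nil expr0.
  rewrite big_cons exprS EFinM; apply: lee_pmul; last exact: IH.
  - exact: measure_ge0.
  - by apply: prode_ge0 => j _; exact: measure_ge0.
  - exact: waiting_time_le_half.
apply/lee_addgt0Pr => e e0; rewrite add0e.
have [k ke] : exists k, (2^-1 : R) ^+ k <= e.
  have [k _ /(_ _ (leqnn _)) ?] := near_infty_natSinv_expn_lt (PosNum e0).
  by exists k; rewrite exprVn -div1r ltW.
by apply: le_trans (H k) _; rewrite lee_fin.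
Qed.

(* The first waiting time [X] of one particle is independent of the value [Y] it
   would need for a tie; cutting the line into cells [I m] of length [e], on each
   of which [X] has mass at most [e], bounds the probability of [X = Y] by [e]. *)
Lemma clock_times_neq : {ae P, forall w, forall j k,
  clock_time (fun i n => E i n w) true j != clock_time (fun i n => E i n w) false k}.
Proof.
(* The sign condition is kept because the cells used below cover only the half-line from 0. *)
suff H j k : P.-negligible [set w | 0 <= E true 0%N w /\
    clock_time (fun i n => E i n w) true j = clock_time (fun i n => E i n w) false k].
  have H1 := negligible_bigcup (fun j => negligible_bigcup (H j)).
  apply: negligibleS (negligibleU H1 waiting_time_gt0) => w /=.
  move=> /existsNP[j /existsNP[k /negP/negPn/eqP jk]].
  case: (pselect (forall i n, 0 < E i n w)) => [pos|]; last by right.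
  by left; exists j => //; exists k => //; split => //; exact: ltW.
pose i0 : (bool * nat) + (bool * nat) := inl (true, 0%N).
pose Y w := clock_time (fun i n => E i n w) false k -
  \sum_(n < j) E true n.+1 w.
have mY : measurable_fun setT
    (Y : sub_sigma (driving_family E U) (predC1 i0) -> R).
  have mX b n : (b, n) != (true, 0%N) -> measurable_fun setT
      (E b n : sub_sigma (driving_family E U) (predC1 i0) -> R).
    move=> bn; apply: (@measurable_sub_sigma _ _ _ _ _ (predC1 i0) (inl (b, n))).
    by rewrite /= /i0; apply: contra bn => /eqP[-> ->].
  apply: measurable_funB; apply: measurable_sum => n; exact: mX.
have mX B : measurable B -> measurable (E true 0%N @^-1` B).
  by move=> mB; rewrite -[_ @^-1` _]setTI; exact: measurable_E.
have indXY (A B : set R) : measurable A -> measurable B ->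
    measurable (Y @^-1` A) /\
    P (Y @^-1` A `&` E true 0%N @^-1` B) =
    (P (Y @^-1` A) * P (E true 0%N @^-1` B))%E.
  move=> mA mB; have := @cylinder_indep _ _ _ _ _ _ indEU (predC1 i0) [:: i0]
    (fun=> B) (Y @^-1` A) isT isT (fun=> mB).
  rewrite /cylinder big_seq1; apply.
  by rewrite -[_ @^-1` _]setTI; exact: mY.
suff H (e : R) : 0 < e -> exists2 S, measurable S /\ (P S <= e%:E)%E &
    [set w | 0 <= E true 0%N w /\ E true 0%N w = Y w] `<=` S.
  pose e (n : nat) : R := n.+1%:R^-1.
  have e0 n : 0 < e n by rewrite invr_gt0.
  pose S n := sval (cid2 (H _ (e0 n))).
  have mS n : measurable (S n) by rewrite /S; case: cid2 => /= ? [].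
  have PS n : (P (S n) <= (e n)%:E)%E by rewrite /S; case: cid2 => /= ? [].
  have SS n : [set w | 0 <= E true 0%N w /\ E true 0%N w = Y w] `<=` S n.
    by rewrite /S; case: cid2.
  exists (\bigcap_n S n); split; first exact: bigcapT_measurable.
    apply/eqP; rewrite eq_le measure_ge0 andbT.
    apply/lee_addgt0Pr => x x0; rewrite add0e.
    have [n _ /(_ _ (leqnn _)) /= nx] := near_infty_natSinv_lt (PosNum x0).
    apply: (@le_trans _ _ (P (S n))).
      by apply: le_measure; rewrite ?inE//; [exact: bigcapT_measurable|exact: bigcap_inf].
    by apply: le_trans (PS n) _; rewrite lee_fin ltW.
  move=> w [X0 jk] n _; apply: SS; split=> //.
  move: jk; rewrite /Y /clock_time big_ord_recl => <-.
  rewrite (eq_bigr (fun n : 'I_j => E true n.+1 w)); first by rewrite addrK.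
  by move=> i _; rewrite lift0.
move=> e0; pose I m : set R := `[m%:R * e, m.+1%:R * e[%classic.
have mI m : measurable (I m) by exact: measurable_itv.
have tI : trivIset setT I.
  move=> m n _ _ [x []]; rewrite /I/= !in_itv/= => /andP[a1 a2] /andP[b1 b2].
  have := le_lt_trans a1 b2; have := le_lt_trans b1 a2.
  by rewrite !ltr_pM2r// !ltr_nat; lia.
have tY : trivIset setT (fun m => Y @^-1` I m).
  by move=> m n ? ? [w [/= ? ?]]; apply: tI => //; exists (Y w).
pose G m := Y @^-1` I m `&` E true 0%N @^-1` I m.
have mG m : measurable (G m).
  by apply: measurableI; [exact: (indXY _ _ (mI m) (mI m)).1|exact: mX].
exists (\bigcup_m G m); first split.
- exact: bigcup_measurable.
- rewrite measure_bigcup//=; last first.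
    exact: trivIset_setIr.
  apply: (@le_trans _ _ (\sum_(0 <= m <oo | m \in setT) (e%:E * P (Y @^-1` I m)))%E).
    apply: lee_nneseries => [m _ _|m _]; first exact: measure_ge0.
    rewrite (indXY _ _ (mI m) (mI m)).2 muleC lee_wpmul2r ?measure_ge0//.
    rewrite expE//; apply: le_trans (exponential_prob1_le _) _ => //.
    rewrite setIidl => [|x]; last first.
      rewrite /I/= in_itv/= => /andP[+ _]; apply: le_trans.
      by rewrite mulr_ge0// ltW.
    rewrite /= lebesgue_measure_itv/= lte_fin ltr_pM2r// ltr_nat ltnSn.
    by rewrite -EFinD lee_fin -mulrBl -natr1 addrAC subrr add0r mul1r.
  rewrite nneseriesZl; last by move=> m _; exact: measure_ge0.
  rewrite -measure_bigcup//=.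
    rewrite -[leRHS]mule1 lee_wpmul2l ?lee_fin ?(ltW e0)//.
    apply: probability_le1; apply: bigcup_measurable => m _.
    exact: (indXY _ _ (mI m) (mI m)).1.
  by move=> m _; exact: (indXY _ _ (mI m) (mI m)).1.
- move=> w [X0 XY]; have := truncn_itv (divr_ge0 X0 (ltW e0)).
  rewrite ler_pdivlMr// ltr_pdivrMr// => H.
  by exists (Num.truncn (E true 0%N w / e)) => //; split; rewrite /= /I/= in_itv -?XY.
Qed.

End Clocks.

(** * Histories of the jump chain *)

Section Histories.
Variables (R : realType) (Delta a : R) (x0 : bool -> int).
Implicit Types (c : config R) (h : seq (bool * bool)).

(** The effect of [jump] on positions, weights and counters, with the direction prescribed instead
    of read off the noise. *)
Definition move c (i dir : bool) : config R :=
  let v := cpos c i in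
  Config (fun j => if j == i then (if dir then v + 1 else v - 1) else cpos c j)
         (incr_edge (cw c) (if dir then v else v - 1))
         (fun j => if j == i then (ccnt c j).+1 else ccnt c j)
         0.

(* A history lists the jumps, latest first, as pairs (moving particle, whether
   it jumped right); the field [ctime] of the resulting configuration is junk. *)
Fixpoint play h : config R :=
  if h is (i, dir) :: h' then move (play h') i dir else init_config a x0.

Definition jump_prob h i : R := right_prob Delta (cw (play h)) (cpos (play h) i).

Section Driven.
Variables E U : bool -> nat -> R.
Local Notation state := (state Delta a x0 E U).

Definition goes_right c i := U i (ccnt c i) < right_prob Delta (cw c) (cpos c i).

Fixpoint history n : seq (bool * bool) :=
  if n is n'.+1 then
    let i := next_particle E (state n') in
    (i, goes_right (state n') i) :: history n'
  else [::].

Lemma size_history n : size (history n) = n.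
Proof. by elim: n => //= n ->. Qed.

Lemma state_play n :
  [/\ cpos (state n) = cpos (play (history n)),
      cw (state n) = cw (play (history n)) &
      ccnt (state n) = ccnt (play (history n))].
Proof.
elim: n => [|n [e1 e2 e3]]; first by split.
by rewrite /= /next_particle /goes_right /= e1 e2 e3; split.
Qed.

Fixpoint schedule_agrees h : Prop :=
  if h is (i, _) :: h' then next_particle E (play h') = i /\ schedule_agrees h'
  else True.

Fixpoint directions_agree h : Prop :=
  if h is (i, dir) :: h' then
    goes_right (play h') i = dir /\ directions_agree h'
  else True.

(** For a fixed [h] all configurations are known, so following [h] splits into a condition on [E]
    alone and a condition on [U] alone. *)
Lemma history_eqP h :
  history (size h) = h <-> schedule_agrees h /\ directions_agree h.
Proof.
elim: h => //= -[i dir] h IH.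
have [e1 e2 e3] := state_play (size h).
rewrite /next_particle /goes_right e1 e2 e3; split.
  move=> [ei er eh]; move: ei er; rewrite eh.
  by move: (IH.1 eh) => [? ?] -> er; do !split; rewrite -?er.
by move=> [[ei sh] [er dh]]; rewrite (IH.2 (conj sh dh)) ei er.
Qed.

End Driven.

Hypothesis Delta_ge0 : 0 <= Delta.
Hypothesis Delta_lt1 : Delta < 1.
Hypothesis a_gt0 : 0 < a.

Lemma play_weight_gt0 h u : 0 < cw (play h) u.
Proof.
elim: h u => [|[i dir] h IH] u //=.
by rewrite /incr_edge; case: ifP => _ //; rewrite ltr_wpDr.
Qed.

Lemma jump_prob_itv h i : 0 <= jump_prob h i <= 1.
Proof.
rewrite /jump_prob /right_prob; move: (play_weight_gt0 h).
set w := cw _; set v := cpos _ _ => w0; have := w0 v; have := w0 (v - 1).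
move: (w v) (w (v - 1)) Delta_ge0 => p q D0 q0 p0; apply/andP; split.
  by rewrite divr_ge0; lra.
by rewrite ler_pdivrMr; lra.
Qed.

Definition potential h : R :=
  resistance (cw (play h)) (cpos (play h) false) (cpos (play h) true).

Lemma potentialE h i : potential h =
  resistance (cw (play h)) (cpos (play h) i) (cpos (play h) (~~ i)).
Proof. by case: i => //; rewrite /potential resistance_sym. Qed.

Definition step_drift h (i : bool) : R :=
  let w := cw (play h) in let v := cpos (play h) i in
  if cpos (play h) (~~ i) < v then drift Delta (w v) (w (v - 1))
  else drift Delta (w (v - 1)) (w v).

Lemma step_drift_ge0 h i : 0 <= step_drift h i.
Proof.
have pw := play_weight_gt0 h.
rewrite /step_drift /drift; case: ifP => _; rewrite divr_ge0 ?subr_ge0 ?(ltW Delta_lt1)//.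
  by rewrite mulr_ge0 ?addr_ge0//; exact: ltW.
by rewrite mulr_ge0 ?addr_ge0//; exact: ltW.
Qed.

Lemma potential_drift h i : cpos (play h) false != cpos (play h) true ->
  jump_prob h i * potential ((i, true) :: h) +
  (1 - jump_prob h i) * potential ((i, false) :: h) + step_drift h i <= potential h.
Proof.
move=> ne; rewrite !(potentialE _ i) /= eqxx.
have -> : (~~ i == i) = false by case: (i).
apply: resistance_drift => //; first exact: play_weight_gt0.
by case: (i) ne => // ; rewrite eq_sym.
Qed.

(** * The potential killed at a meeting *)

Section Apart.
Variable N : nat.

(* No meeting along the history [h], from the [N]-th jump on. *)
Fixpoint apart h : bool :=
  ((size h < N)%N || (cpos (play h) false != cpos (play h) true)) &&
  (if h is _ :: h' then apart h' else true).

Definition apart_potential h : R := if apart h then potential h else 0.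

(** The loss is charged to the history after the step because it depends on which particle moved. *)
Definition last_drift h : R :=
  if h is (i, _) :: h' then (if apart h' then step_drift h' i else 0) else 0.

Lemma potential_ge0 h : 0 <= potential h.
Proof. by apply: resistance_ge0; exact: play_weight_gt0. Qed.

Lemma apart_potential_ge0 h : 0 <= apart_potential h.
Proof. by rewrite /apart_potential; case: ifP => // _; exact: potential_ge0. Qed.

Lemma last_drift_ge0 h : 0 <= last_drift h.
Proof. by case: h => [|[i d] h] //=; case: ifP => // _; exact: step_drift_ge0. Qed.

(** While [apart] holds, [potential_drift] applies and killing can only lower the nonnegative
    potential; once it fails, both sides vanish. *)
Lemma apart_potential_drift h i : (N <= size h)%N ->
  let f dir := let h' := (i, dir) :: h in apart_potential h' + last_drift h' in
  jump_prob h i * f true + (1 - jump_prob h i) * f false <= apart_potential h.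
Proof.
move=> Nh /=; have le_pot dir : apart h ->
    apart_potential ((i, dir) :: h) <= potential ((i, dir) :: h).
  by rewrite /apart_potential; case: ifP => // _ _; exact: potential_ge0.
case: (boolP (apart h)) => [ap|nap]; last first.
  by rewrite /apart_potential /= (negbTE nap) !andbF !addr0 !mulr0 addr0.
have ne : cpos (play h) false != cpos (play h) true.
  by move: ap; case: (h) Nh => [|x h'] /= Nh /andP[]; rewrite ltnNge Nh.
have /andP[j0 j1] := jump_prob_itv h i.
have := potential_drift i ne; have := le_pot true ap; have := le_pot false ap.
have -> : apart_potential h = potential h by rewrite /apart_potential ap.
move: (jump_prob h i) j0 j1 => p p0 p1.
move=> /(ler_wpM2l (_ : 0 <= 1 - p)) H1 /(ler_wpM2l p0) H2 H.
have := H1 ltac:(lra); move: H2 H; rewrite !mulrDr; lra.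
Qed.

Fixpoint histories n : seq (seq (bool * bool)) :=
  if n is n'.+1 then
    [seq x :: h | h <- histories n',
       x <- [:: (true, true); (true, false); (false, true); (false, false)]]
  else [:: [::]].

Lemma mem_histories n h : (h \in histories n) = (size h == n).
Proof.
elim: n h => [|n IH] h; first by rewrite /= inE; case: h.
apply/allpairsPdep/idP => /=.
  by move=> [h' [x [hn _ ->]]] /=; rewrite eqSS -IH.
case: h => // x h; rewrite /= eqSS -IH => hn; exists h, x; split => //.
by case: x => -[] [].
Qed.

Lemma histories_uniq n : uniq (histories n).
Proof.
elim: n => // n IH; apply: allpairs_uniq_dep => // -[h x] [h' x'] _ _ /= [-> ->] //.
Qed.

Lemma big_histories n (F : seq (bool * bool) -> R) :
  \sum_(h <- histories n.+1) F h = \sum_(h <- histories n)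
    (F ((true, true) :: h) + (F ((true, false) :: h) +
    (F ((false, true) :: h) + F ((false, false) :: h)))).
Proof.
rewrite /histories -/histories big_allpairs_dep; apply: eq_bigr => h _.
by rewrite !big_cons big_nil /= addr0.
Qed.

(* [pr h] plays the probability of the history [h], and [q h i] that of [h]
   being followed by a move of the particle [i]. *)
Lemma expected_drift_sum (pr : seq (bool * bool) -> R)
    (q : seq (bool * bool) -> bool -> R) :
  (forall h i, 0 <= q h i) -> (forall h, pr h = q h true + q h false) ->
  (forall h i (dir : bool), pr ((i, dir) :: h) =
    q h i * (if dir then jump_prob h i else 1 - jump_prob h i)) ->
  forall n, \sum_(k < n) \sum_(h <- histories (N + k).+1) pr h * last_drift h <=
    \sum_(h <- histories N) pr h * apart_potential h.
Proof.
move=> q0 prq prS.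
have step n : (N <= n)%N ->
    \sum_(h <- histories n.+1) pr h * apart_potential h +
    \sum_(h <- histories n.+1) pr h * last_drift h <=
    \sum_(h <- histories n) pr h * apart_potential h.
  move=> Nn; rewrite -big_split big_histories /= big_seq [leRHS]big_seq.
  apply: ler_sum => h; rewrite mem_histories => /eqP hn.
  rewrite !prS -!mulrDr prq mulrDl addrA.
  have Nh : (N <= size h)%N by rewrite hn.
  (* The inequality holds for each mover separately, so it can be averaged with the weights [q h i],
     whatever the law of the order of moves. *)
  have H1 := ler_wpM2l (q0 h true) (apart_potential_drift true Nh).
  have H2 := ler_wpM2l (q0 h false) (apart_potential_drift false Nh).
  apply: le_trans (lerD H1 H2); rewrite le_eqVlt; apply/orP; left; apply/eqP.
  by rewrite /=; ring.
have pr0 h : 0 <= pr h by rewrite prq addr_ge0.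
(* Telescoping, with the remaining expected potential kept on the left for the induction. *)
have S n : \sum_(k < n) \sum_(h <- histories (N + k).+1) pr h * last_drift h +
    \sum_(h <- histories (N + n)) pr h * apart_potential h <=
    \sum_(h <- histories N) pr h * apart_potential h.
  elim: n => [|n IH]; first by rewrite big_ord0 add0r addn0.
  rewrite big_ord_recr /= addnS; apply: le_trans IH.
  by rewrite -addrA lerD2l addrC step// leq_addr.
move=> n; apply: le_trans (S n); rewrite lerDl; apply: sumr_ge0 => h _.
by rewrite mulr_ge0// apart_potential_ge0.
Qed.

End Apart.

End Histories.

(** * Paths without meetings *)

Section Pathwise.
Variables (R : realType) (Delta a : R) (x0 : bool -> int).
Variables E U : bool -> nat -> R.
Hypothesis Delta_ge0 : 0 <= Delta.
Hypothesis Delta_lt1 : Delta < 1.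
Hypothesis a_gt0 : 0 < a.
Hypothesis E_gt0 : forall i n, 0 < E i n.
Hypothesis E_gt_half : forall i m, exists2 n, (m <= n)%N & 2^-1 < E i n.
Hypothesis clocks_neq : forall j k, clock_time E true j != clock_time E false k.
Local Notation state := (state Delta a x0 E U).
Local Notation mover n := (next_particle E (state n)).

Lemma clock_timeS i k : clock_time E i k.+1 = clock_time E i k + E i k.+1.
Proof. by rewrite /clock_time big_ord_recr. Qed.

Lemma clock_time_le i j k : (j <= k)%N -> clock_time E i j <= clock_time E i k.
Proof.
move=> /subnKC <-; elim: (k - j)%N => [|m IH]; first by rewrite addn0.
by rewrite addnS clock_timeS (le_trans IH)// lerDl ltW.
Qed.

Lemma clock_time_unbounded i M : exists k, M < clock_time E i k.
Proof.
suff H m : exists k, m%:R / 2 < clock_time E i k.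
  have [k Hk] := H (Num.truncn (2 * `|M|)).+1; exists k; apply: le_lt_trans Hk.
  rewrite ler_pdivlMr// mulrC.
  have := truncnS_gt (2 * `|M|); have := ler_norm M; lra.
elim: m => [|m [k IH]].
  by exists 0%N; rewrite mul0r /clock_time big_ord1.
have [[//|n] kn En] := E_gt_half i k.+1; exists n.+1.
have := clock_time_le i (kn : (k <= n)%N).
by rewrite clock_timeS -natr1; lra.
Qed.

Lemma ccntS n i : ccnt (state n.+1) i = (ccnt (state n) i + (mover n == i))%N.
Proof. by rewrite /= eq_sym; case: ifP => _; rewrite ?addn1 ?addn0. Qed.

(** If [i] stopped moving, its pending ring time would stay fixed while the ring times of the other
    clock pass it. *)
Lemma mover_infinitely_often i K : exists2 n, (K <= n)%N & mover n = i.
Proof.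
apply: contrapT => nomove.
have H n : (K <= n)%N -> mover n = ~~ i.
  move=> Kn; case: (eqVneq (mover n) i) => [e|]; last by case: (mover n) (i) => -[].
  by case: nomove; exists n.
have cnt m : ccnt (state (K + m)) i = ccnt (state K) i /\
    ccnt (state (K + m)) (~~ i) = (ccnt (state K) (~~ i) + m)%N.
  elim: m => [|m [IH1 IH2]]; first by rewrite !addn0.
  by rewrite addnS !ccntS H ?leq_addr// IH1 IH2 eqxx; split; case: (i); lia.
have [k Hk] := clock_time_unbounded (~~ i) (clock_time E i (ccnt (state K) i)).
have [c1 c2] := cnt k.
have := H (K + k)%N (leq_addr _ _); rewrite /next_particle.
have Hk' := clock_time_le (~~ i) (leq_addl (ccnt (state K) (~~ i)) k).
have := lt_le_trans Hk Hk'.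
case: (i) c1 c2 => /= -> -> lt; first by rewrite lt.
by rewrite ltNge (ltW lt).
Qed.

Lemma ccnt_le i m n : (m <= n)%N -> (ccnt (state m) i <= ccnt (state n) i)%N.
Proof.
move=> /subnKC <-; elim: (n - m)%N => [|k IH]; first by rewrite addn0.
by rewrite addnS ccntS (leq_trans IH)// leq_addr.
Qed.

Lemma ccnt_unbounded i k : exists n, (k <= ccnt (state n) i)%N.
Proof.
elim: k => [|k [n IH]]; first by exists 0%N.
have [m nm mi] := mover_infinitely_often i n; exists m.+1.
by rewrite ccntS mi eqxx addn1 ltnS (leq_trans IH)// ccnt_le.
Qed.

(** A repeated mover waits a positive time; a new mover had a pending ring that lost the previous
    comparison, strictly since ties are excluded. Hence each state is occupied for a positive
    time. *)
Lemma ctime_lt n : ctime (state n) < ctime (state n.+1).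
Proof.
case: n => [|n]; first by rewrite /= /clock_time big_ord1.
have -> : ctime (state n.+2) = clock_time E (mover n.+1) (ccnt (state n.+1) (mover n.+1)) by [].
have -> : ctime (state n.+1) = clock_time E (mover n) (ccnt (state n) (mover n)) by [].
rewrite ccntS; case: (eqVneq (mover n) (mover n.+1)) => [<-|ne].
  by rewrite addn1 clock_timeS ltrDl.
rewrite addn0; have -> : mover n.+1 = ~~ mover n by case: (mover n) (mover n.+1) ne => -[].
case mv: (mover n) => /=; move: mv; rewrite /next_particle // => /negbT.
by rewrite -leNgt => le; rewrite lt_neqAle le eq_sym clocks_neq.
Qed.

Lemma ctime_le m n : (m <= n)%N -> ctime (state m) <= ctime (state n).
Proof.
move=> /subnKC <-; elim: (n - m)%N => [|k IH]; first by rewrite addn0.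
by rewrite addnS (le_trans IH)// ltW// ctime_lt.
Qed.

Lemma ctime_unbounded M : exists n, M <= ctime (state n).
Proof.
have [k Mk] := clock_time_unbounded true M.
have [m km] := ccnt_unbounded true k.
have [n mn nt] := mover_infinitely_often true m; exists n.+1.
rewrite /= nt; apply: le_trans (ltW Mk) _; apply: clock_time_le.
by rewrite (leq_trans km)// ccnt_le.
Qed.

Lemma cw_bounds n u : 0 < cw (state n) u <= a + n%:R.
Proof.
elim: n u => [|n IH] u /=; first by rewrite a_gt0 addr0 lexx.
have := IH u; rewrite /incr_edge -natr1; case: ifP => _; lra.
Qed.

Section Separated.
Variables (N : nat) (C : R).
Hypothesis separated : forall n, (N <= n)%N ->
  cpos (state n) false != cpos (state n) true.

(** The label of the right particle at jump [N]; earlier meetings may have exchanged the labels. *)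
Let rt := cpos (state N) false < cpos (state N) true.

Lemma state_nn_step n :
  cpos (state n.+1) (~~ mover n) = cpos (state n) (~~ mover n) /\
  nn_step (cpos (state n) (mover n)) (cpos (state n.+1) (mover n))
    (cw (state n)) (cw (state n.+1)).
Proof.
rewrite /= eqxx; split; first by case: (mover n).
by case: ifP => _; [left|right].
Qed.

(** One particle moves at a time, by one site, so the order cannot be reversed without a meeting. *)
Lemma right_particle k : cpos (state (N + k)) (~~ rt) < cpos (state (N + k)) rt.
Proof.
elim: k => [|k].
  have := separated (leqnn N); rewrite addn0 /rt.
  by case: (ltgtP (cpos _ false) (cpos _ true)).
have := separated (leq_addr k.+1 N); rewrite addnS.
have [same st] := state_nn_step (N + k).
have st' : cpos (state (N + k).+1) (mover (N + k)) = cpos (state (N + k)) (mover (N + k)) + 1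
  \/ cpos (state (N + k).+1) (mover (N + k)) = cpos (state (N + k)) (mover (N + k)) - 1.
  by case: st => -[-> _]; [left|right].
move: same st'; move: (cpos (state (N + k).+1)) (cpos (state (N + k))) => p' p.
by case: (mover (N + k)); case: (rt) => /=; lia.
Qed.

Lemma separated_two_walks : two_walks
  (fun k => cpos (state (N + k)) rt) (fun k => cpos (state (N + k)) (~~ rt))
  (fun k => cw (state (N + k))) (fun k => mover (N + k) == rt).
Proof.
move=> k; split; first exact: right_particle.
have [same st] := state_nn_step (N + k); rewrite addnS.
case: eqVneq => [<- //|ne].
have e : mover (N + k) = ~~ rt by case: (mover (N + k)) (rt) ne => -[].
by move: same st; rewrite e negbK.
Qed.

Lemma separated_apart n : apart a x0 N (history Delta a x0 E U n).
Proof.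
elim: n => [|n IH].
  rewrite /= andbT; case: (ltnP 0 N) => //; rewrite leqn0 => /eqP N0.
  by have := separated (n := 0%N); rewrite N0 => /(_ isT) /=.
have [e _ _] := state_play Delta a x0 E U n.+1.
set h := history Delta a x0 E U in e IH *.
rewrite (_ : apart _ _ _ _ = ((size (h n.+1) < N)%N ||
  (cpos (play a x0 (h n.+1)) false != cpos (play a x0 (h n.+1)) true)) &&
  apart a x0 N (h n))// -e IH andbT size_history.
by case: ltnP => //; exact: separated.
Qed.

(** Along such a path [apart] never fails, so [last_drift] is the actual drift of each step and
    [two_walks_drift_unsummable] applies from jump [N], where weights are at most [a + N]. *)
Lemma separated_drift_unsummable :
  (forall m, \sum_(k < m) last_drift Delta a x0 N
    (history Delta a x0 E U (N + k).+1) <= C) -> False.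
Proof.
move=> sumC.
have stepE k : last_drift Delta a x0 N (history Delta a x0 E U (N + k).+1) =
    let w := cw (state (N + k)) in let v := cpos (state (N + k)) (mover (N + k)) in
    if cpos (state (N + k)) (~~ mover (N + k)) < v
    then drift Delta (w v) (w (v - 1)) else drift Delta (w (v - 1)) (w v).
  rewrite /= separated_apart /step_drift.
  by have [-> -> _] := state_play Delta a x0 E U (N + k).
apply: (two_walks_drift_unsummable separated_two_walks Delta_ge0 Delta_lt1
  (A := a + N%:R) (delta := fun k => last_drift Delta a x0 N
    (history Delta a x0 E U (N + k).+1)) _ _ _ _ _ sumC) => [u|u|k|k /eqP e|k|K].
- by rewrite addn0; have /andP[] := cw_bounds N u.
- by rewrite addn0; have /andP[] := cw_bounds N u.
- exact: (last_drift_ge0 _ Delta_ge0 Delta_lt1 a_gt0).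
- by rewrite stepE e /= right_particle.
- case: eqVneq => // ne _; rewrite stepE.
  have -> : mover (N + k) = ~~ rt by case: (mover (N + k)) (rt) ne => -[].
  by rewrite negbK /= ltNge (ltW (right_particle k)).
- have [n Kn nr] := mover_infinitely_often rt (N + K).
  exists (n - N)%N; first by lia.
  by rewrite subnKC ?nr ?eqxx//; lia.
Qed.

End Separated.

Lemma meetings_unbounded :
  (forall N, exists2 n, (N <= n)%N & cpos (state n) false = cpos (state n) true) ->
  forall M : R, exists t : R, M <= t /\ meet_at Delta a x0 E U t.
Proof.
move=> meet M; have [N MN] := ctime_unbounded M.
have [n Nn pn] := meet N; exists (ctime (state n)); split.
  exact: le_trans MN (ctime_le Nn).
by exists n; rewrite lexx ctime_lt.
Qed.

End Pathwise.

(** * The law of the history *)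

Section HistoryLaw.
Context (R : realType) (d : measure_display) (T : measurableType d).
Variables (P : probability T R) (E U : bool -> nat -> T -> R).
Variables (Delta a : R) (x0 : bool -> int).
Hypothesis Delta_ge0 : 0 <= Delta.
Hypothesis a_gt0 : 0 < a.
Hypothesis indEU : mutually_independent P (driving_family E U).
Hypothesis unifU : forall i n B, measurable B ->
  P (U i n @^-1` B) = uniform_prob (@ltr01 R) B.

Let Ew w i n := E i n w.
Let Uw w i n := U i n w.
Let X := driving_family E U.
Let K : pred ((bool * nat) + (bool * nat)) := fun k => if k is inl _ then true else false.
Local Notation hist w := (history Delta a x0 (Ew w) (Uw w)).

Definition schedule_event h : set T := [set w | schedule_agrees a x0 (Ew w) h].
Definition directions_event h : set T :=
  [set w | directions_agree Delta a x0 (Uw w) h].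
Definition mover_event h i : set T :=
  [set w | next_particle (Ew w) (play a x0 h) = i].

Fixpoint used_marks (h : seq (bool * bool)) : seq ((bool * nat) + (bool * nat)) :=
  if h is (i, _) :: h' then inr (i, ccnt (play a x0 h') i) :: used_marks h'
  else [::].

Definition mark_range (dir : bool) (rho : R) : set R :=
  if dir then `]-oo, rho[%classic else ~` `]-oo, rho[%classic.

(** The value [setT] leaves the variables that [h] does not consume unconstrained. *)
Fixpoint mark_ranges (h : seq (bool * bool)) (k : (bool * nat) + (bool * nat)) : set R :=
  if h is (i, dir) :: h' then
    if k == inr (i, ccnt (play a x0 h') i) then mark_range dir (jump_prob Delta a x0 h' i)
    else mark_ranges h' k
  else setT.

Lemma measurable_mark_range dir rho : measurable (mark_range dir rho).
Proof. by rewrite /mark_range; case: dir; [|apply: measurableC]; exact: measurable_itv. Qed.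

Lemma measurable_mark_ranges h k : measurable (mark_ranges h k).
Proof.
by elim: h => [|[i dir] h IH] //=; case: ifP => // _; exact: measurable_mark_range.
Qed.

(** The counter exceeds the index of every mark consumed so far, so each jump reads a fresh mark. *)
Lemma used_marks_lt h i k : inr (i, k) \in used_marks h -> (k < ccnt (play a x0 h) i)%N.
Proof.
elim: h => [|[j dir] h IH] //=; rewrite inE => /predU1P[[-> ->]|/IH].
  by rewrite eqxx.
by case: ifP => // _ ?; exact: ltnW.
Qed.

Lemma used_marks_fresh h i : inr (i, ccnt (play a x0 h) i) \notin used_marks h.
Proof. by apply/negP => /used_marks_lt; rewrite ltnn. Qed.

Lemma used_marks_uniq h : uniq (used_marks h).
Proof. by elim: h => [|[i dir] h IH] //=; rewrite IH used_marks_fresh. Qed.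

Lemma used_marks_inr h : all [predC K] (used_marks h).
Proof. by elim: h => [|[i dir] h IH]. Qed.

Lemma mark_ranges_cons h i dir : cylinder X (used_marks h) (mark_ranges ((i, dir) :: h)) =
  cylinder X (used_marks h) (mark_ranges h).
Proof.
apply: eq_big_seq => k kh /=; case: eqP => // e.
by move: kh; rewrite e (negbTE (used_marks_fresh _ _)).
Qed.

(** With [h] fixed, the jump probabilities are plain numbers, so each mark is constrained
    separately. *)
Lemma directions_eventE h :
  directions_event h = cylinder X (used_marks h) (mark_ranges h).
Proof.
elim: h => [|[i dir] h IH].
  by rewrite /cylinder big_nil; apply/seteqP; split.
rewrite /cylinder big_cons -/(cylinder X (used_marks h) _) mark_ranges_cons -IH /= eqxx.
apply/seteqP; split=> w /=; rewrite /goes_right /mark_range -/(jump_prob _ _ _ _ _).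
  by move=> [<- ?]; split=> //; case: ifP; rewrite /= in_itv/= => ->.
move=> [+ ?]; case: dir; rewrite /= in_itv/= => H; split=> //.
by apply/negbTE/negP.
Qed.

Let cylU h A := @cylinder_indep _ _ _ _ _ _ indEU K (used_marks h) (mark_ranges h) A
  (used_marks_uniq h) (used_marks_inr h) (@measurable_mark_ranges h).

Lemma measurable_mover_event h i :
  measurable (mover_event h i : set (sub_sigma X K)).
Proof.
have mE j n : measurable_fun setT (E j n : sub_sigma X K -> R).
  exact: (@measurable_sub_sigma _ _ _ _ X K (inl (j, n))).
have mclock j n : measurable_fun setT
    ((fun w => clock_time (Ew w) j n) : sub_sigma X K -> R).
  by apply: measurable_sum => k; exact: mE.
have := measurable_fun_ltr (mclock true (ccnt (play a x0 h) true))
  (mclock false (ccnt (play a x0 h) false)).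
by move=> /(_ measurableT [set i] I); rewrite setTI.
Qed.

Lemma measurable_schedule_event h :
  measurable (schedule_event h : set (sub_sigma X K)).
Proof.
elim: h => [|[i dir] h IH]; first exact: measurableT.
exact: measurableI (measurable_mover_event h i) IH.
Qed.

Lemma measurable_directions_event h : measurable (directions_event h).
Proof.
by rewrite directions_eventE; apply: (measurable_cylinder indEU); exact: measurable_mark_ranges.
Qed.

(* The order of the moves depends on the waiting times only, and the directions,
   once the order is fixed, on the uniform marks only. *)
Lemma schedule_directions_indep h (A : set T) :
  measurable (A : set (sub_sigma X K)) -> measurable A /\
  P (A `&` directions_event h) = (P A * P (directions_event h))%E.
Proof. by rewrite directions_eventE; exact: cylU. Qed.

Lemma directions_event_cons h i dir :
  let rho := jump_prob Delta a x0 h i in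
  P (directions_event ((i, dir) :: h)) =
    ((if dir then rho else 1 - rho)%:E * P (directions_event h))%E.
Proof.
rewrite !directions_eventE /cylinder !indEU.2; last first.
- exact: measurable_mark_ranges.
- exact: used_marks_uniq.
- exact: measurable_mark_ranges.
- exact: used_marks_uniq.
rewrite big_cons /= eqxx; congr (_ * _)%E.
  have mI : measurable (`]-oo, jump_prob Delta a x0 h i[%classic : set R) by exact: measurable_itv.
  have H := uniform_prob_lt (jump_prob_itv x0 Delta_ge0 a_gt0 h i).
  case: dir; rewrite /mark_range; first by rewrite unifU.
  rewrite [X in P X](_ : _ = ~` (U i (ccnt (play a x0 h) i) @^-1`
    `]-oo, jump_prob Delta a x0 h i[%classic))//.
  rewrite probability_setC; first by rewrite unifU ?H.
  by rewrite -[_ @^-1` _]setTI; exact: (indEU.1 (inr (i, _))).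
apply: eq_big_seq => k kh; case: eqP => // e.
by move: kh; rewrite e (negbTE (used_marks_fresh _ _)).
Qed.

Definition history_event h : set T := [set w | hist w (size h) = h].

Lemma history_eventE h : history_event h = schedule_event h `&` directions_event h.
Proof. by apply/seteqP; split=> w /history_eqP. Qed.

Lemma measurable_history_event h : measurable (history_event h).
Proof.
rewrite history_eventE; apply: measurableI; last exact: measurable_directions_event.
by have [] := schedule_directions_indep h (measurable_schedule_event h).
Qed.

Definition history_prob h : R := fine (P (history_event h)).

(** This is the [q] of [expected_drift_sum]. *)
Definition next_prob h i : R :=
  fine (P (mover_event h i `&` schedule_event h `&` directions_event h)).

Let msched h i : measurable (mover_event h i `&` schedule_event h).
Proof.
by have [] := schedule_directions_indep h
  (measurableI _ _ (measurable_mover_event h i) (measurable_schedule_event h)).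
Qed.

Lemma history_prob_next h : history_prob h = next_prob h true + next_prob h false.
Proof.
rewrite /history_prob /next_prob history_eventE -fineD; last 2 first.
- by apply: fin_num_measure; apply: measurableI => //; exact: measurable_directions_event.
- by apply: fin_num_measure; apply: measurableI => //; exact: measurable_directions_event.
congr fine; rewrite -measureU; last first.
- apply/seteqP; split=> // w [[[/= + _] _] [[/= + _] _]].
  by rewrite /mover_event /= => ->.
- by apply: measurableI => //; exact: measurable_directions_event.
- by apply: measurableI => //; exact: measurable_directions_event.
congr (P _); rewrite -!setIUl; congr (_ `&` _).
apply/seteqP; split=> w; last by move=> [].
by move=> sw; split=> //; rewrite /mover_event /=; case: next_particle; [left|right].
Qed.

(** The order of moves is a clock event, independent of the directions; the fresh mark then
    contributes its own factor. *)
Lemma history_prob_cons h i dir : history_prob ((i, dir) :: h) = next_prob h i *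
  (if dir then jump_prob Delta a x0 h i else 1 - jump_prob Delta a x0 h i).
Proof.
rewrite /history_prob /next_prob history_eventE.
have mS := measurableI _ _ (measurable_mover_event h i) (measurable_schedule_event h).
rewrite [schedule_event _]/(mover_event h i `&` schedule_event h).
rewrite (schedule_directions_indep _ mS).2 (schedule_directions_indep _ mS).2.
rewrite directions_event_cons.
have : P (mover_event h i `&` schedule_event h) \is a fin_num.
  by apply: fin_num_measure; exact: msched.
have : P (directions_event h) \is a fin_num.
  by apply: fin_num_measure; exact: measurable_directions_event.
case: (P (directions_event h)) => // t _; case: (P (_ `&` _)) => // s _ /=.
by ring.
Qed.

(** The history of length [n] takes finitely many values, so expectations become the finite sums of
    [expected_drift_sum]. *)
Lemma integral_history (F : seq (bool * bool) -> R) n : (forall h, 0 <= F h) ->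
  measurable_fun setT (fun w => (F (hist w n))%:E) /\
  (\int[P]_w (F (hist w n))%:E =
   (\sum_(h <- histories n) history_prob h * F h)%:E)%E.
Proof.
move=> F0.
have FE : (fun w => (F (hist w n))%:E) =
    (fun w => \sum_(h <- histories n) (F h)%:E * (\1_(history_event h) w)%:E)%E.
  apply/funext => w.
  have hn : hist w n \in histories n by rewrite mem_histories size_history.
  rewrite (bigD1_seq (hist w n)) ?histories_uniq//= big_seq_cond big1.
    by rewrite indicE mem_set ?mule1 ?adde0// /history_event /= size_history.
  move=> h /andP[]; rewrite mem_histories => /eqP hh ne.
  rewrite indicE memNset ?mule0// /history_event /= hh => e.
  by rewrite e eqxx in ne.
have mf h : measurable_fun setT (fun w => (F h)%:E * (\1_(history_event h) w)%:E)%E.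
  apply: measurable_funeM; apply/measurable_EFinP; apply: measurable_indic.
  exact: measurable_history_event.
split; first by rewrite FE; apply: emeasurable_sum.
rewrite FE ge0_integral_sum//; last first.
  by move=> h w _; rewrite mule_ge0// lee_fin.
rewrite -sumEFin; apply: eq_bigr => h _.
rewrite ge0_integralZl ?lee_fin//; last first.
  by apply/measurable_EFinP; apply: measurable_indic; exact: measurable_history_event.
rewrite integral_indic//; last exact: measurable_history_event.
rewrite setIT EFinM muleC fineK// fin_num_measure//; exact: measurable_history_event.
Qed.

(** The expected partial sums are bounded, so the infinite sum is integrable and hence almost surely
    finite. *)
Lemma last_drift_summable (Delta_lt1 : Delta < 1) N : {ae P, forall w, exists C : R,
  forall m, \sum_(k < m) last_drift Delta a x0 N (hist w (N + k).+1) <= C}.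
Proof.
pose f k w := (last_drift Delta a x0 N (hist w (N + k).+1))%:E.
have F0 h := last_drift_ge0 x0 Delta_ge0 Delta_lt1 a_gt0 N h.
have f0 k w : (0 <= f k w)%E by rewrite lee_fin.
have mf k : measurable_fun setT (f k) := (integral_history (N + k).+1 F0).1.
have intf : P.-integrable setT (fun w => \sum_(0 <= k <oo) f k w)%E.
  apply/integrableP; split; first exact: ge0_emeasurable_sum.
  under eq_integral do rewrite gee0_abs ?nneseries_ge0//.
  rewrite integral_nneseries//.
  (* The expected potential at jump [N], finite as a finite sum. *)
  pose C := \sum_(h <- histories N) history_prob h * apart_potential a x0 N h.
  apply: (@le_lt_trans _ _ C%:E); last exact: ltry.
  apply: lime_le; first by apply: is_cvg_nneseries => *; exact: integral_ge0.
  apply: nearW => m /=; rewrite big_mkord.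
  rewrite (eq_bigr _ (fun (k : 'I_m) _ => (integral_history (N + k).+1 F0).2)).
  rewrite sumEFin lee_fin.
  apply: (expected_drift_sum Delta_ge0 a_gt0 N (q := next_prob)).
  - by move=> h i; apply: fine_ge0; exact: measure_ge0.
  - exact: history_prob_next.
  - exact: history_prob_cons.
apply: filterS (integrable_ae measurableT intf) => w /(_ I) fin.
exists (fine (\sum_(0 <= k <oo) f k w)%E) => m.
rewrite -lee_fin fineK// -sumEFin -(big_mkord xpredT (fun k => f k w)).
by apply: nneseries_lim_ge => k _ _; exact: f0.
Qed.

End HistoryLaw.

(** * Almost sure recurrence *)

Theorem theorem1 (R : realType) (Delta a : R) (l0 r0 : int)
  (d : measure_display) (T : measurableType d) (P : probability T R)
  (E U : bool -> nat -> T -> R) :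
  0 <= Delta -> Delta < 1 -> 0 < a -> l0 < r0 ->
  mutually_independent P (driving_family E U) ->
  (forall i n B, measurable B -> P (E i n @^-1` B) = exponential_prob 1 B) ->
  (forall i n B, measurable B ->
     P (U i n @^-1` B) = uniform_prob (@ltr01 R) B) ->
  {ae P, forall w : T,
     forall M : R, exists t : R, M <= t /\
       meet_at Delta a (fun i : bool => if i then r0 else l0)
         (fun i n => E i n w) (fun i n => U i n w) t}.
Proof.
move=> D0 D1 a0 _ indEU expE unifU; pose x0 i : int := if i then r0 else l0.
(* One null set serves all [N], since the last meeting of a path could come at any jump. *)
have summable := ae_foralln (fun N =>
  last_drift_summable x0 D0 a0 indEU unifU D1 N).
have E0 := waiting_time_gt0 indEU expE.
have E1 := waiting_time_gt_half indEU expE.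
have E2 := clock_times_neq indEU expE.
apply: filterS (filterI summable (filterI E0 (filterI E1 E2))) => w.
move=> [sumw [Ew0 [Ew1 Ew2]]].
apply: meetings_unbounded => //; move=> N; apply: contrapT => nomeet.
have [C sumC] := sumw N.
apply: (separated_drift_unsummable D0 D1 a0 _ _ (N := N) _ sumC) => //.
by move=> n Nn; apply/eqP => e; apply: nomeet; exists n.
Qed.
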